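(* Let $G$ be a group acting on a set $X$ such that there exists a point stabilizer $H=G_x$ (for some $x\in X$) for which the set of $G$-orbits contained in $\mathcal{B}_{[H]}$ is infinite. Then $\mathrm{Aut}_G(X)$ is not finitely generated, and consequently $\mathrm{End}_G(X)$ is not finitely generated.
   Context: $\mathrm{End}_G(X)$ is the monoid (under composition) of $G$-equivariant functions $X\to X$ and $\mathrm{Aut}_G(X)$ is its group of units (the $G$-equivariant bijections). $G_x$ is the stabilizer of $x$, $[H]$ is the $G$-conjugacy class of the subgroup $H$, and $\mathcal{B}_{[H]}=\{y\in X:[G_y]=[H]\}$. *)

(* Defs.v *)
From HB Require Import structures.
From mathcomp Require Import all_boot monoid.
From mathcomp Require Import boolp classical_sets functions cardinality.

Set Implicit Arguments.
Unset Strict Implicit.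
Unset Printing Implicit Defensive.

Local Open Scope classical_set_scope.
Local Open Scope group_scope.

Definition fg_monoid (M : monoidType) : Prop :=
  exists2 A : set M, finite_set A &
    smallest [set S : set M | monoid_closed (mem S)] A = setT.

Definition fg_group (G : groupType) : Prop :=
  exists2 A : set G, finite_set A &
    smallest [set S : set G | group_closed (mem S)] A = setT.

(* The inverse is stored as data; it is determined by munit_val, so this type
   is the set of invertible elements (munit_val_inj, munitP). *)
Record munit (M : monoidType) := MUnit {
  munit_val :> M;
  munit_inv : M;
  munitV : munit_val * munit_inv = 1;
  munitVl : munit_inv * munit_val = 1 }.

HB.instance Definition _ (M : monoidType) := gen_eqMixin (munit M).
HB.instance Definition _ (M : monoidType) := gen_choiceMixin (munit M).

Section Units.
Variable M : monoidType.
Implicit Types u v w : munit M.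

Lemma munit_val_inj : injective (@munit_val M).
Proof.
case=> [u u' h1 h2] [v v' k1 k2] /= e; subst v.
have e : u' = v' by rewrite -[u']mulg1 -k1 mulgA h2 mul1g.
subst v'; congr MUnit; exact: Prop_irrelevance.
Qed.

Lemma munitP (m : M) :
  (exists u, munit_val u = m) <-> (exists n, m * n = 1 /\ n * m = 1).
Proof.
split; first by case=> u <-; exists (munit_inv u); split; case: u.
by case=> n [h1 h2]; exists (MUnit h1 h2).
Qed.

Definition munit_one : munit M := MUnit (mulg1 1) (mulg1 1).

Definition munit_mul u v : munit M.
Proof.
apply: (@MUnit M (munit_val u * munit_val v) (munit_inv v * munit_inv u)).
- by rewrite mulgA -[X in X * _]mulgA munitV mulg1 munitV.
- by rewrite mulgA -[X in X * _]mulgA munitVl mulg1 munitVl.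
Defined.

Definition munit_invg u : munit M := MUnit (munitVl u) (munitV u).

Lemma munit_mulA : associative munit_mul.
Proof. by move=> u v w; apply: munit_val_inj; rewrite /= mulgA. Qed.
Lemma munit_mul1 : left_id munit_one munit_mul.
Proof. by move=> u; apply: munit_val_inj; rewrite /= mul1g. Qed.
Lemma munit_mulr1 : right_id munit_one munit_mul.
Proof. by move=> u; apply: munit_val_inj; rewrite /= mulg1. Qed.
Lemma munit_mulV : left_inverse munit_one munit_invg munit_mul.
Proof. by move=> u; apply: munit_val_inj; rewrite /= munitVl. Qed.
Lemma munit_mulrV : right_inverse munit_one munit_invg munit_mul.
Proof. by move=> u; apply: munit_val_inj; rewrite /= munitV. Qed.
End Units.

HB.instance Definition _ (M : monoidType) := isGroup.Build (munit M)
  (@munit_mulA M) (@munit_mul1 M) (@munit_mulr1 M)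
  (@munit_mulV M) (@munit_mulrV M).

Record gaction (G : groupType) (X : Type) := GAction {
  gact :> G -> X -> X;
  gact1 : forall x, gact 1 x = x;
  gactM : forall g h x, gact (g * h) x = gact g (gact h x) }.

Section Action.
Variables (G : groupType) (X : Type) (a : gaction G X).

Definition stab (x : X) : set G := [set g | a g x = x].

Definition gorbit (x : X) : set X := range (fun g => a g x).

Definition gorbits : set (set X) := range gorbit.

(* Note that [_ ^ g] is conjugation, h ^ g = g^-1 * (h * g). *)
Definition conj_class (H : set G) : set (set G) :=
  range (fun g => [set h ^ g | h in H]).

Definition stab_box (H : set G) : set X :=
  [set y | conj_class (stab y) = conj_class H].

Definition equivariant (f : X -> X) : Prop :=
  forall g x, f (a g x) = a g (f x).

Record EndG := MkEndG {
  EndG_fun :> X -> X;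
  EndG_equivariant : equivariant EndG_fun }.

Lemma EndG_inj : injective EndG_fun.
Proof.
case=> f hf [k hk] /= e; subst k; congr MkEndG; exact: Prop_irrelevance.
Qed.

Lemma equivariant_id : equivariant id. Proof. by []. Qed.

Lemma equivariant_comp f k :
  equivariant f -> equivariant k -> equivariant (f \o k).
Proof. by move=> hf hk g x; rewrite /= hk hf. Qed.

Definition EndG_one : EndG := MkEndG equivariant_id.

Definition EndG_mul (f k : EndG) : EndG :=
  MkEndG (equivariant_comp (@EndG_equivariant f) (@EndG_equivariant k)).

Lemma EndG_mulA : associative EndG_mul.
Proof. by move=> f k l; apply: EndG_inj. Qed.
Lemma EndG_mul1 : left_id EndG_one EndG_mul.
Proof. by move=> f; apply: EndG_inj. Qed.
Lemma EndG_mulr1 : right_id EndG_one EndG_mul.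
Proof. by move=> f; apply: EndG_inj. Qed.

HB.instance Definition _ := gen_eqMixin EndG.
HB.instance Definition _ := gen_choiceMixin EndG.
HB.instance Definition _ := isMonoid.Build EndG EndG_mulA EndG_mul1 EndG_mulr1.

Definition AutG := munit EndG.

Lemma AutGP (f : X -> X) :
  (exists u : AutG, EndG_fun (munit_val u) = f) <->
  equivariant f /\ bijective f.
Proof.
split=> [[[u v uv vu] /= <-]|[ef [k fk kf]]].
  split; first exact: EndG_equivariant.
  by exists v => x; [move/(congr1 EndG_fun): vu|move/(congr1 EndG_fun): uv];
    move/(congr1 (fun f => f x)).
have ek : equivariant k by move=> g x; rewrite -{1}(kf x) -ef fk.
have h1 : MkEndG ef * MkEndG ek = 1 by apply: EndG_inj; apply/funext => x /=.
have h2 : MkEndG ek * MkEndG ef = 1 by apply: EndG_inj; apply/funext => x /=.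
by exists (MUnit h1 h2).
Qed.
End Action.

(* Main.v *)
Require Import Defs.
From mathcomp Require Import all_boot monoid.
From mathcomp Require Import boolp classical_sets functions cardinality.

(** A finitely generated monoid or group is countable, so it suffices to embed
    the power set of [nat] into [AutG a], which itself embeds into [EndG a].
    From infinitely many orbits in [stab_box a H], choose points [x (n, b)] in
    distinct orbits, all with stabilizer exactly [H]. Any self-map of the indices
    extends, through [a g (x i) |-> a g (x (p i))], to an equivariant map, and a
    set [S] of naturals gives the automorphism swapping the orbits of
    [x (n, false)] and [x (n, true)] exactly for [n] in [S]. *)

Set Implicit Arguments.
Unset Strict Implicit.
Unset Printing Implicit Defensive.

Local Open Scope classical_set_scope.
Local Open Scope group_scope.

(** Cantor's diagonal argument, with each set [S] coded by the number [f S]. *)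
Lemma powerset_nat_not_injective (f : set nat -> nat) : ~ injective f.
Proof.
move=> finj; pose D := [set n | exists2 S, f S = n & ~ S n].
have nD : ~ D (f D) by move=> DfD; case: (DfD) => S /finj ->.
by apply/nD; exists D.
Qed.

Lemma injective_powerset_not_countable (T : Type) (f : set nat -> T) :
  injective f -> ~ countable [set: T].
Proof.
move=> finj /countable_injP[g ginj]; apply: (@powerset_nat_not_injective (g \o f)).
by move=> S S' /ginj; rewrite !inE => /(_ I I) /finj.
Qed.

Lemma countable_word_image (W : countType) (T : Type) (ev : W -> T) :
  range ev = setT -> countable [set: T].
Proof.
by move=> <-; apply: sub_countable (card_image_le _ _) (countableP _).
Qed.

Lemma fg_monoid_countable (M : monoidType) :
  fg_monoid M -> countable [set: M].
Proof.
case=> A /finite_seqP[s ->] gen.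
(* Words are lists of positions in [s]; positions past the end evaluate to the default [1], which is
   harmless. *)
apply: (@countable_word_image _ _ (fun w : seq nat => \prod_(i <- w) nth 1 s i)).
rewrite -subTset -gen; apply: smallest_sub; last first.
  by move=> m /= ms; exists [:: index m s] => //; rewrite big_seq1 nth_index.
split; first by rewrite inE; exists [::]; rewrite ?big_nil.
move=> u v; rewrite !inE => -[w _ <-] [w' _ <-].
by exists (w ++ w'); rewrite ?big_cat.
Qed.

Lemma fg_group_countable (G : groupType) : fg_group G -> countable [set: G].
Proof.
case=> A /finite_seqP[s ->] gen.
pose e (p : nat * bool) : G := if p.2 then (nth 1 s p.1)^-1 else nth 1 s p.1.
have eV p : (e p)^-1 = e (p.1, ~~ p.2).
  by rewrite /e; case: p => i [] /=; rewrite ?invgK.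
apply: (@countable_word_image _ _ (fun w : seq (nat * bool) => \prod_(p <- w) e p)).
rewrite -subTset -gen; apply: smallest_sub; last first.
  move=> m /= ms; exists [:: (index m s, false)] => //.
  by rewrite big_seq1 /e /= nth_index.
split; first by rewrite inE; exists [::]; rewrite ?big_nil.
move=> u v; rewrite !inE => -[w _ <-] [w' _ <-].
(* Closure is tested on [u * v^-1]: a word is inverted by reversing it and flipping the inversion
   flags. *)
exists (w ++ rev [seq (p.1, ~~ p.2) | p <- w']) => //.
rewrite big_cat -map_rev big_map; congr (_ * _).
under eq_bigr => p _ do rewrite -eV.
by rewrite prodgV revK.
Qed.

Section Action.
Variables (G : groupType) (X : Type) (a : gaction G X).

Lemma gactK g : cancel (a g) (a g^-1).
Proof. by move=> x; rewrite -gactM mulVg gact1. Qed.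

Lemma gactVK g : cancel (a g^-1) (a g).
Proof. by move=> x; rewrite -gactM mulgV gact1. Qed.

Lemma stab_act g x : stab a (a g^-1 x) = [set h ^ g | h in stab a x].
Proof.
apply/seteqP; split=> [h hx|_ [h /= hx <-]]; rewrite /stab /=.
  exists (h ^ g^-1); last by rewrite -conjgM mulVg conjg1.
  by rewrite /stab /= conjgE invgK !gactM hx gactVK.
by rewrite conjgE !gactM gactVK hx.
Qed.

Lemma gorbit_act g x : gorbit a (a g x) = gorbit a x.
Proof.
apply/seteqP; split=> [_ [h _ <-]|_ [h _ <-]].
  by exists (h * g) => //; rewrite gactM.
by exists (h * g^-1) => //; rewrite gactM gactK.
Qed.

Lemma conj_class_refl (H : set G) : conj_class H H.
Proof.
exists 1 => //; rewrite (_ : (fun h => _) = id) ?image_id//.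
by apply/funext => h; rewrite conjg1.
Qed.

Lemma stab_box_orbit (H : set G) (O : set X) :
  gorbits a O -> O `<=` stab_box a H ->
  exists2 x, gorbit a x = O & stab a x = H.
Proof.
move=> [x _ <-] /(_ x) /(_ (ex_intro2 _ _ 1 I (gact1 a x))) /= xH.
(* [H] is itself a conjugate of [stab a x], so moving [x] along its orbit makes the stabilizer equal
   to [H]. *)
have := conj_class_refl H; rewrite -xH => -[g _ gH].
by exists (a g^-1 x); rewrite ?gorbit_act ?stab_act.
Qed.

(** Distinct orbits make the index [i] of a point [a g (x i)] unique, and equal stabilizers make
    [a g (x (p i))] independent of [g]. Points outside the chosen orbits stay fixed. *)
Lemma orbit_map_extension (I : Type) (x : I -> X) :
  injective (fun i => gorbit a (x i)) ->
  (forall i j, stab a (x i) = stab a (x j)) ->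
  exists f : (I -> I) -> EndG a,
    [/\ forall p i, f p (x i) = x (p i),
        forall p q, f (p \o q) = f p * f q & f id = 1].
Proof.
move=> xinj xstab.
pose R (p : I -> I) z z' := (exists i g, z = a g (x i) /\ z' = a g (x (p i))) \/
  (~ (exists i g, z = a g (x i)) /\ z' = z).
(* This uniqueness later yields equivariance, multiplicativity and [f id = 1]: in each case both
   sides are [R]-related to the same point. *)
have Rfun p z z1 z2 : R p z z1 -> R p z z2 -> z1 = z2.
  move=> [[i [g [-> ->]]]|[nz ->]] [[j [h []]]|[nz' ->]] //.
  - move=> e ->; have ij : i = j.
      by apply: xinj; rewrite /= -(gorbit_act g) e gorbit_act.
    subst j; have /= : stab a (x i) (h^-1 * g).
      by rewrite /stab /= gactM e gactK.
    rewrite (xstab i (p i)) /stab /= gactM => {2}<-.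
    by rewrite gactVK.
  - by case: nz'; exists i, g.
  - by move=> zE; case: nz; exists j, h.
have /choice[F FR] : forall pz : (I -> I) * X, exists z', R pz.1 pz.2 z'.
  move=> [p z]; case: (pselect (exists i g, z = a g (x i))) => [[i [g ->]]|nz].
    by exists (a g (x (p i))); left; exists i, g.
  by exists z; right.
have Feq p : equivariant a (fun z => F (p, z)).
  move=> h z; apply: (Rfun p (a h z)); first exact: (FR (p, a h z)).
  case: (FR (p, z)) => /= [[i [g [zE ->]]]|[nz ->]]; [left|right].
    by exists i, (h * g); rewrite zE !gactM.
  split=> // -[i [g /(congr1 (a h^-1))]]; rewrite gactK => zE.
  by apply: nz; exists i, (h^-1 * g); rewrite gactM.
exists (fun p => MkEndG (Feq p)); split=> [p i|p q|] /=.
- apply: (Rfun p (x i)); first exact: (FR (p, x i)).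
  by left; exists i, 1; rewrite !gact1.
- apply: EndG_inj; apply/funext => z /=.
  apply: (Rfun (p \o q) z); first exact: (FR (p \o q, z)).
  have := FR (q, z); have := FR (p, F (q, z)) => /=.
  move=> Rp [[i [g [zE qE]]]|[nz qE]]; rewrite qE in Rp *.
    left; exists i, g; split=> //; apply: (Rfun _ _ _ _ Rp).
    by left; exists (q i), g.
  by right; split=> //; apply: (Rfun _ _ _ _ Rp); right.
- apply: EndG_inj; apply/funext => z /=.
  apply: (Rfun id z); first exact: (FR (id, z)).
  case: (pselect (exists i g, z = a g (x i))) => [[i [g ->]]|nz]; last by right.
  by left; exists i, g.
Qed.

Lemma powerset_embeds_AutG (H : set G) :
  infinite_set [set O : set X | gorbits a O /\ O `<=` stab_box a H] ->
  exists f : set nat -> AutG a, injective f.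
Proof.
move=> /infiniteP/pcard_leP/injfunPex[O Obox Oinj].
have /choice[x xP] n : exists x, gorbit a x = O n /\ stab a x = H.
  by have [//|On OH] := Obox n; have [y] := stab_box_orbit On OH; exists y.
(* Encoding pairs as naturals splits the sequence of orbits into pairs to be swapped. *)
pose y (i : nat * bool) := x (choice.pickle i).
have yinj : injective (fun i => gorbit a (y i)).
  move=> i j /=; rewrite !(proj1 (xP _)) => /Oinj; rewrite !inE => /(_ I I).
  exact: pcan_inj choice.pickleK _ _.
have [|f [fy fM f1]] := orbit_map_extension yinj.
  by move=> i j; rewrite !(proj2 (xP _)).
pose p (S : set nat) (i : nat * bool) := (i.1, i.2 (+) `[< S i.1 >]).
have pK S : p S \o p S = id.
  by apply/funext => -[n b]; rewrite /p /= -addbA addbb addbF.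
(* Being an involution, [f (p S)] serves as its own inverse in [MUnit]. *)
have fK S : f (p S) * f (p S) = 1 by rewrite -fM pK.
exists (fun S => MUnit (fK S) (fK S)) => S T /(congr1 (@munit_val _)) /= fST.
apply/funext => n; rewrite -[S n]asboolE -[T n]asboolE.
(* The flag of [p S (n, false)] is the truth value of [S n], so the image of [y (n, false)]
   determines it. *)
have : y (p S (n, false)) = y (p T (n, false)) by rewrite -!fy fST.
by move/(congr1 (gorbit a))/yinj => -[->].
Qed.

End Action.

Theorem corollary23 (G : groupType) (X : Type) (a : gaction G X)
  (hinf : exists2 H : set G, (exists x : X, H = stab a x) &
     infinite_set [set O : set X | gorbits a O /\ O `<=` stab_box a H]%classic) :
  ~ fg_group (AutG a) /\ ~ fg_monoid (EndG a).
Proof.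
case: hinf => H _ /powerset_embeds_AutG[f finj]; split.
  by move/fg_group_countable; apply: injective_powerset_not_countable finj.
move/fg_monoid_countable.
exact: injective_powerset_not_countable (inj_comp (@munit_val_inj _) finj).
Qed.
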